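(* For any graph $G$, $$\gamma_I(G)+\partial_s(G)=n(G).$$
   Context: Graphs are finite, simple, undirected, with non-empty vertex set; $n(G)=|V(G)|$ and $N(v)$ is the open neighbourhood of $v$. For $D\subseteq V(G)$: $N_e(D)=\{u\in V(G)\setminus D:\ N(u)\cap D\ne\varnothing\}$; for $v\in D$, $\mathrm{epn}(v,D)=\{u\in V(G)\setminus D:\ N(u)\cap D=\{v\}\}$; $D_w=\{v\in D:\ \mathrm{epn}(v,D)\neq\varnothing\}$. The strong differential of $D$ is $\partial_s(D)=|N_e(D)|-|D_w|$, and the strong differential of $G$ is $\partial_s(G)=\max\{\partial_s(D):\ D\subseteq V(G)\}$. An Italian dominating function on $G$ is a function $f:V(G)\to\{0,1,2\}$ such that $\sum_{u\in N(v)}f(u)\ge 2$ for every $v\in V(G)$ with $f(v)=0$; its weight is $\sum_{v\in V(G)}f(v)$. The Italian domination number $\gamma_I(G)$ is the minimum weight among all Italian dominating functions on $G$. *)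

(* Defs.v *)
From mathcomp Require Import all_boot all_order all_algebra.

Set Implicit Arguments.
Unset Strict Implicit.
Unset Printing Implicit Defensive.

(* A graph is given by its adjacency relation [e] on a finite type [V] of
   vertices; symmetry, irreflexivity and non-emptiness are hypotheses of the
   theorems. *)

Definition nbhd (V : finType) (e : rel V) (v : V) : {set V} :=
  [set u | e v u].

(* N_e(D) *)
Definition ext_nbhd (V : finType) (e : rel V) (D : {set V}) : {set V} :=
  [set u in ~: D | nbhd e u :&: D != set0].

Definition epn (V : finType) (e : rel V) (v : V) (D : {set V}) : {set V} :=
  [set u in ~: D | nbhd e u :&: D == [set v]].

(* D_w *)
Definition epn_part (V : finType) (e : rel V) (D : {set V}) : {set V} :=
  [set v in D | epn e v D != set0].

(* The subtraction is in [int], hence not truncated. *)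
Definition set_strong_differential (V : finType) (e : rel V) (D : {set V}) :
    int :=
  (#|ext_nbhd e D|%:Z - #|epn_part e D|%:Z)%R.

(* The maximum is seeded with the value at one of the sets it ranges over, so
   it is the true maximum over all subsets. *)
Definition strong_differential (V : finType) (e : rel V) : int :=
  \big[Order.max/set_strong_differential e set0]_(D : {set V})
    set_strong_differential e D.

Definition italian_dominating (V : finType) (e : rel V)
    (f : {ffun V -> 'I_3}) : bool :=
  [forall v : V, (f v == 0 :> nat) ==> (2 <= \sum_(u in nbhd e v) f u)].

Definition weight (V : finType) (f : {ffun V -> 'I_3}) : nat :=
  \sum_(v : V) f v.

Definition const2 (V : finType) : {ffun V -> 'I_3} := [ffun=> ord_max].

(* [arg min] needs a feasible starting point: [const2] is one. *)
Lemma italian_dominating_const2 (V : finType) (e : rel V) :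
  italian_dominating e (const2 V).
Proof. by apply/forallP => v; rewrite ffunE. Qed.

Definition italian_domination_number (V : finType) (e : rel V) : nat :=
  weight [arg min_(f < const2 V | italian_dominating e f) weight f].

(* Main.v *)
Require Import Defs.
From mathcomp Require Import all_boot all_order all_algebra.
From mathcomp Require Import zify.

(** A set [D] gives the Italian dominating function equal to [2] on [D_w], to
    [0] on [N_e(D)] and to [1] elsewhere, of weight [n - |N_e(D)| + |D_w|].
    Conversely, if [f] is Italian dominating and [D] is the support of [f], then
    [N_e(D)] is the zero set of [f], and [f = 2] on [D_w]: a private neighbour of
    [v] gets all of its weight from [v]. *)

Import Order.TTheory.

Section StrongDifferential.
Variables (V : finType) (e : rel V).
Implicit Types (D A : {set V}) (f : {ffun V -> 'I_3}).

Lemma cardE_sum A : #|A| = \sum_v (v \in A).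
Proof. by rewrite -sum1_card big_mkcond; apply: eq_bigr => v _; case: ifP. Qed.

Lemma italian_of_set D : exists2 f,
  italian_dominating e f & weight f + #|ext_nbhd e D| = #|V| + #|epn_part e D|.
Proof.
(* As D_w lies inside [D] and N_e(D) outside it, the two indicators add up to 0 on N_e(D), 2 on D_w
   and 1 elsewhere. *)
pose f := [ffun v => inord ((v \notin ext_nbhd e D) + (v \in epn_part e D))]
  : {ffun V -> 'I_3}.
have fE v : f v = (v \notin ext_nbhd e D) + (v \in epn_part e D) :> nat.
  by rewrite ffunE inordK //; do 2!case: (_ \in _).
have f_gt0 v : v \in D -> 0 < f v by rewrite fE !inE => ->.
exists f; last first.
  rewrite !cardE_sum -sum1_card -!big_split /=; apply: eq_bigr => v _.
  by rewrite fE addnAC; case: (_ \in ext_nbhd _ _).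
apply/forallP => v; apply/implyP; rewrite fE addn_eq0 eqb0 negbK => /andP[vN _].
have [vD /set0Pn[u uI]] : v \notin D /\ nbhd e v :&: D != set0.
  by move: vN; rewrite inE in_setC => /andP.
have /andP[uv uD] : (u \in nbhd e v) && (u \in D) by rewrite -in_setI.
rewrite (bigD1 u) //=.
(* If [u] is the only neighbour of [v] in [D], then [v] is private to [u], so [u] is in D_w and
   alone contributes 2. Otherwise a second neighbour [w] in [D] exists, and each of the two
   contributes at least 1. *)
have [epnE | /eqP epnN] := eqVneq (nbhd e v :&: D) [set u].
  apply: leq_trans (leq_addr _ _).
  rewrite fE !inE uD /=; case: set0Pn => // -[].
  by exists v; rewrite !inE vD epnE /=.
have [w wI wu] : exists2 w, w \in nbhd e v :&: D & w != u.
  apply/exists_inP; apply: contra_notT epnN => /exists_inPn wN.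
  apply/setP => w; rewrite in_set1; apply/idP/eqP => [/wN|-> //].
  by rewrite negbK => /eqP.
have /andP[wv wD] : (w \in nbhd e v) && (w \in D) by rewrite -in_setI.
rewrite (bigD1 w) /=; last by rewrite wv.
by have := f_gt0 _ uD; have := f_gt0 _ wD; lia.
Qed.

Lemma set_of_italian f : italian_dominating e f ->
  exists D, #|V| + #|epn_part e D| <= weight f + #|ext_nbhd e D|.
Proof.
move=> /forallP f_dom; pose D := [set v | f v != 0 :> nat]; exists D.
have sum_nbhd v : \sum_(u in nbhd e v) f u = \sum_(u in nbhd e v :&: D) f u.
  rewrite (big_setID D) /= [X in _ + X]big1 ?addn0 // => u.
  by rewrite !inE negbK => /andP[/eqP].
(* The inequality already holds at each vertex: where [f v = 0], [v] counts in N_e(D) and not in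
   D_w; elsewhere [f v] is at least 1, and at least 2 on D_w. *)
rewrite !cardE_sum -sum1_card -!big_split /=; apply: leq_sum => v _.
have epn_f2 : v \in epn_part e D -> 2 <= f v.
  rewrite inE => /andP[_ /set0Pn[u]].
  rewrite !inE negbK => /andP[fu0 /eqP nbhd_u].
  by have /implyP/(_ fu0) := f_dom u; rewrite sum_nbhd nbhd_u big_set1.
have f0_ext : f v == 0 :> nat -> v \in ext_nbhd e D.
  move=> fv0; rewrite !inE fv0 /=; apply/eqP => nbhd_v.
  by have /implyP/(_ fv0) := f_dom v; rewrite sum_nbhd nbhd_v big_set0.
by case: (v \in epn_part _ _) epn_f2; case: (v \in ext_nbhd _ _) f0_ext; lia.
Qed.

End StrongDifferential.

Theorem theorem3p4 (V : finType) (e : rel V)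
    (e_sym : symmetric e) (e_irr : irreflexive e) (V_gt0 : 0 < #|V|) :
  ((italian_domination_number e)%:Z + strong_differential e = #|V|%:Z)%R.
Proof.
rewrite /italian_domination_number.
case: arg_minnP => [|f f_dom f_min]; first exact: italian_dominating_const2.
(* [D] yields an Italian dominating function of weight n minus the differential of [D], and [f] has
   minimum weight. *)
have diff_le D : (set_strong_differential e D <= #|V|%:Z - (weight f)%:Z)%R.
  have [g /f_min g_min g_weight] := italian_of_set _ e D.
  by rewrite /set_strong_differential; lia.
(* The set built from the minimum [f] attains this bound. *)
have [D D_le] := set_of_italian _ _ _ f_dom.
have le_diff : (strong_differential e <= #|V|%:Z - (weight f)%:Z)%R.
  by apply: bigmax_le => [|D' _]; exact: diff_le.
have diff_ge : (set_strong_differential e D <= strong_differential e)%R.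
  exact: le_bigmax.
by move: diff_ge; rewrite {1}/set_strong_differential; lia.
Qed.
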